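(* Let $(X,\mathcal U)$ be a quasi-uniform space whose quasi-uniformity is generated by an $F$-quasi-gauge $D$ (i.e. $\mathcal U=\mathcal U_D$), and let $f:X\to\mathbb R\cup\{\infty\}$. Suppose that $(X,\mathcal U)$ is sequentially right $K$-complete, the topology $\tau(\mathcal U)$ is $T_1$, $f$ is proper and bounded below, and for every $x\in X$ the set $$S_f(x)=\{y\in X: f(y)+d(y,x)\le f(x)\ \text{ for all } d\in D\}$$ is sequentially $\mathcal U$-closed. Then for every $x_0\in\operatorname{dom} f$ there exists $z\in X$ such that (i) for all $d\in D$, $f(z)+d(z,x_0)\le f(x_0)$; and (ii) for every $x\in X\setminus\{z\}$ there exists $d_x\in D$ such that $f(z)<f(x)+d_x(x,z)$.
   Context: A quasi-uniformity on a set $X$ is a nonempty family $\mathcal U$ of subsets of $X\times X$ which contain the diagonal, closed under supersets and finite intersections, such that for every $U\in\mathcal U$ there is $V\in\mathcal U$ with $V\circ V\subseteq U$, where $M\circ N=\{(x,z):\exists y,\ (x,y)\in M,\ (y,z)\in N\}$. The topology $\tau(\mathcal U)$ has $\{U(x):U\in\mathcal U\}$, $U(x)=\{y\in X:(x,y)\in U\}$, as neighborhood basis at $x$. An $F$-quasi-gauge on $X$ is a family $D$ of functions $d:X\times X\to\mathbb R$ such that: (QF1) $D$ is directed upward (for the pointwise order); (QF2) $d(x,y)\ge 0$ and $d(x,x)=0$ for all $d\in D$, $x,y\in X$; (QF3) for every $d\in D$ there is $d'\in D$ with $d'\ge d$ such that $d(x,y)\le d'(x,z)+d'(z,y)$ for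 all $x,y,z\in X$. It generates the quasi-uniformity $\mathcal U_D$ having as basis the sets $V_{d,\varepsilon}=\{(x,y)\in X\times X: d(x,y)<\varepsilon\}$, $d\in D$, $\varepsilon>0$. A sequence $(x_n)$ is right $K$-Cauchy if for every $U\in\mathcal U$ there is $n_U\in\mathbb N$ such that $(x_{n+k},x_n)\in U$ for all $n\ge n_U$ and all $k\in\mathbb N$. $(X,\mathcal U)$ is sequentially right $K$-complete if every right $K$-Cauchy sequence is $\tau(\mathcal U)$-convergent to some point of $X$. A set is sequentially $\mathcal U$-closed if it contains every $\tau(\mathcal U)$-limit of every sequence of its elements. $\operatorname{dom} f=\{x: f(x)<\infty\}$; $f$ is proper if $\operatorname{dom} f\neq\emptyset$. *)

(* Defs.v *)
From HB Require Import structures.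
From mathcomp Require Import all_boot all_order all_algebra.
From mathcomp Require Import all_classical all_reals.
From mathcomp Require Import topology.

Set Implicit Arguments.
Unset Strict Implicit.
Unset Printing Implicit Defensive.

Import Order.TTheory GRing.Theory Num.Theory.
Local Open Scope classical_set_scope.
Local Open Scope ring_scope.

(* Quasi-uniform spaces are uniform spaces of MathComp-Analysis without the
   symmetry axiom. The library's [B \; A] composes from right to left, which is
   immaterial for [B \; B]. [nbhs_ U x] consists of the sets that include some
   section [xsection A x = [set y | (x, y) \in A]] with [U A]; so the topology
   is the one with the sets U(x) as neighborhood bases. *)
HB.mixin Record Nbhs_isQuasiUniform_mixin M & Nbhs M := {
  quasi_entourage : set_system (M * M);
  quasi_entourage_filter : Filter quasi_entourage;
  quasi_entourage_diagonal :
    forall A, quasi_entourage A -> diagonal `<=` A;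
  quasi_entourage_split_ex : forall A, quasi_entourage A ->
    exists2 B, quasi_entourage B & (B \; B)%relation `<=` A;
  quasi_nbhsE : nbhs = nbhs_ quasi_entourage;
}.

#[short(type="quasiUniformType")]
HB.structure Definition QuasiUniform :=
  {T of Topological T & Nbhs_isQuasiUniform_mixin T}.

(* Every quasi-uniformity on a choiceType determines a [quasiUniformType]: the
   sets U(x) do form the neighborhood bases of a topology. *)
HB.factory Record isQuasiUniform M & Choice M := {
  quasi_entourage : set_system (M * M);
  quasi_entourage_filter : Filter quasi_entourage;
  quasi_entourage_diagonal :
    forall A, quasi_entourage A -> diagonal `<=` A;
  quasi_entourage_split_ex : forall A, quasi_entourage A ->
    exists2 B, quasi_entourage B & (B \; B)%relation `<=` A;
}.

HB.builders Context M & isQuasiUniform M.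

HB.instance Definition _ := @hasNbhs.Build M (nbhs_ quasi_entourage).

Let nbhs_filter (p : M) : ProperFilter (nbhs p).
Proof.
rewrite /nbhs/= nbhs_E; apply: filter_from_proper; last first.
  move=> A entA; exists p; apply/mem_set.
  exact: (quasi_entourage_diagonal entA).
apply: filter_from_filter.
  by exists setT; exact: @filterT quasi_entourage_filter.
move=> A B entA entB; exists (A `&` B); last by rewrite xsectionI.
exact: (@filterI _ _ quasi_entourage_filter).
Qed.

Let nbhs_singleton (p : M) A : nbhs p A -> A p.
Proof.
move=> [B entB sBpA].
by apply/sBpA/mem_set; exact: (quasi_entourage_diagonal entB).
Qed.

Let nbhs_nbhs (p : M) A : nbhs p A -> nbhs p (nbhs^~ A).
Proof.
move=> [B entB sBpA].
have [C entC sC2B] := quasi_entourage_split_ex entB.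
exists C => // q Cpq; exists C => // r Cqr.
by apply/sBpA/mem_set/sC2B; exists q; exact/set_mem.
Qed.

HB.instance Definition _ := Nbhs_isNbhsTopological.Build M
  nbhs_filter nbhs_singleton nbhs_nbhs.

HB.instance Definition _ := @Nbhs_isQuasiUniform_mixin.Build M quasi_entourage
  quasi_entourage_filter quasi_entourage_diagonal quasi_entourage_split_ex erefl.

HB.end.

Record F_quasi_gauge (R : realType) (X : Type) (D : set (X -> X -> R)) : Prop := {
  gauge_directed : forall d1 d2, D d1 -> D d2 -> exists2 d, D d &
    forall x y, d1 x y <= d x y /\ d2 x y <= d x y;
  gauge_ge0 : forall d, D d -> forall x y, 0 <= d x y;
  gauge_refl : forall d, D d -> forall x, d x x = 0;
  gauge_triangle : forall d, D d -> exists2 d', D d' &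
    (forall x y, d x y <= d' x y) /\
    (forall x y z, d x y <= d' x z + d' z y);
}.

Definition gauge_entourage (R : realType) (X : Type) (D : set (X -> X -> R)) :
    set_system (X * X) :=
  filter_from [set de : (X -> X -> R) * R | D de.1 /\ 0 < de.2]
    (fun de => [set xy | de.1 xy.1 xy.2 < de.2]).

Definition right_K_cauchy (X : quasiUniformType) (x : nat -> X) : Prop :=
  forall U : set (X * X), quasi_entourage U ->
    exists nU : nat, forall n k : nat, (nU <= n)%N -> U (x (n + k)%N, x n).

Definition seq_right_K_complete (X : quasiUniformType) : Prop :=
  forall x : nat -> X, right_K_cauchy x -> exists l : X, x @ \oo --> l.

Definition seq_closed (X : topologicalType) (A : set X) : Prop :=
  forall x : nat -> X, (forall n, A (x n)) ->
  forall l : X, x @ \oo --> l -> A l.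

Section extended_real_functions.
Local Open Scope ereal_scope.

Definition edom (R : realType) (X : Type) (f : X -> \bar R) : set X :=
  [set x | f x < +oo].

Definition proper_fun (R : realType) (X : Type) (f : X -> \bar R) : Prop :=
  edom f !=set0.

Definition bounded_below (R : realType) (X : Type) (f : X -> \bar R) : Prop :=
  exists m : R, forall x, m%:E <= f x.

Definition S_set (R : realType) (X : Type) (D : set (X -> X -> R))
    (f : X -> \bar R) (x : X) : set X :=
  [set y | forall d, D d -> f y + (d y x)%:E <= f x].

End extended_real_functions.

(* Main.v *)
Require Import Defs.
From HB Require Import structures.
From mathcomp Require Import all_boot all_order all_algebra.
From mathcomp Require Import all_classical all_reals.
From mathcomp Require Import topology ereal.

(** An Ekeland variational principle in a quasi-uniform space.

    The sets S(x) = [S_set D f x] are the initial segments of a preorder: [y] is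
    below [x] when f(y) + d(y, x) <= f(x) for every gauge d. Reflexivity comes
    from d(x, x) = 0, transitivity from the triangle inequality of the gauge
    ([S_set_refl], [S_set_trans]), and f is nondecreasing for the preorder. The
    point z looked for is an element below x0 that is minimal: no other point
    is below it.

    Starting at x0, choose x_{n+1} in S(x_n) minimizing f on S(x_n) up to
    1/(n+1) ([decreasing_minimizing_sequence]). If y and w both lie in S(x_n),
    with y below x_{n+1}, then

      f(y) + d(y, x_{n+1}) <= f(x_{n+1}) <= f(w) + 1/(n+1),

    and this single estimate is used twice. With y = w a later term of the
    sequence, it gives d(x_{n+1+k}, x_{n+1}) <= 1/(n+1): the sequence is right
    K-Cauchy ([near_minimizing_right_K_cauchy]), hence has a limit z, and z is
    in every S(x_n) because these sets are sequentially closed and contain the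
    tails of the sequence. With y = z and w below z, it gives f(z) <= f(w) in the
    limit, while f(w) + d(w, z) <= f(z); so d(w, z) = 0 for every d, which means
    w = z in a T1 space ([gauge_eq0_T1]). *)

Set Implicit Arguments.
Unset Strict Implicit.
Unset Printing Implicit Defensive.

Import Order.TTheory GRing.Theory Num.Theory.
Local Open Scope classical_set_scope.
Local Open Scope ereal_scope.

Lemma near_minimizer (R : realType) (X : Type) (f : X -> \bar R)
    (A : set X) (x : X) (e : R) :
  bounded_below f -> A x -> edom f x -> (0 < e)%R ->
  exists2 y, A y & forall w, A w -> f y <= f w + e%:E.
Proof.
move=> [m fm] Ax fx e0.
have inf_le w : A w -> ereal_inf (f @` A) <= f w.
  by move=> Aw; apply: ereal_inf_lbound; exists w.
have inf_fin : ereal_inf (f @` A) \is a fin_num.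
  rewrite fin_numElt (le_lt_trans (inf_le _ Ax) fx) andbT.
  apply: (@lt_le_trans _ _ m%:E); first exact: ltNyr.
  by apply: le_ereal_inf_tmp => _ [w _ <-].
have [_ [y Ay <-] fy] := lb_ereal_inf_adherent e0 inf_fin.
exists y => // w Aw; apply: (le_trans (ltW fy)).
by apply: leeD => //; exact: inf_le.
Qed.

Section gauge_preorder.
Variables (R : realType) (X : Type) (D : set (X -> X -> R)) (f : X -> \bar R).
Hypothesis D_gauge : F_quasi_gauge D.

Lemma S_set_refl x : S_set D f x x.
Proof. by move=> d Dd; rewrite (gauge_refl D_gauge Dd) adde0. Qed.

(** The triangle inequality of a quasi-gauge bounds d by a larger gauge d'; this
    is harmless because membership in S(x) quantifies over all gauges. *)
Lemma S_set_trans x y z : S_set D f x y -> S_set D f y z -> S_set D f x z.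
Proof.
move=> Sxy Syz d Dd; have [d' Dd' [_ tri]] := gauge_triangle D_gauge Dd.
apply: (le_trans _ (Sxy _ Dd')).
apply: (@le_trans _ _ (f z + (d' z y)%:E + (d' y x)%:E)).
  by rewrite -addeA -EFinD; apply: leeD => //; rewrite lee_fin.
by apply: leeD => //; exact: Syz.
Qed.

Lemma S_set_le x y : D !=set0 -> S_set D f x y -> f y <= f x.
Proof.
move=> [d Dd] /(_ _ Dd); apply: le_trans.
by apply: leeDl; rewrite lee_fin; exact: (gauge_ge0 D_gauge Dd).
Qed.

Lemma decreasing_S_set (u : nat -> X) (n k : nat) :
  (forall i, S_set D f (u i) (u i.+1)) -> S_set D f (u n) (u (n + k)%N).
Proof.
move=> uS; elim: k => [|k IH]; first by rewrite addn0; exact: S_set_refl.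
by rewrite addnS; exact: (S_set_trans IH (uS _)).
Qed.

Lemma decreasing_minimizing_sequence (x0 : X) :
  D !=set0 -> bounded_below f -> edom f x0 ->
  exists u : nat -> X, [/\ u 0%N = x0,
    forall n, S_set D f (u n) (u n.+1) &
    forall n w, S_set D f (u n) w -> f (u n.+1) <= f w + (n.+1%:R^-1)%:E].
Proof.
move=> D0 fb fx0.
have /choice[g gP] (p : nat * X) : exists y, edom f p.2 ->
    S_set D f p.2 y /\
    forall w, S_set D f p.2 w -> f y <= f w + (p.1.+1%:R^-1)%:E.
  have [fp|nfp] := pselect (edom f p.2); last by exists p.2.
  have e0 : (0 < p.1.+1%:R^-1 :> R)%R by rewrite invr_gt0 ltr0n.
  by have [y Sy ymin] := near_minimizer fb (@S_set_refl p.2) fp e0; exists y.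
pose u := nat_rect (fun=> X) x0 (fun n x => g (n, x)).
have fu n : edom f (u n).
  elim: n => [//|n IH]; have [Sg _] := gP (n, u n) IH.
  exact: le_lt_trans (S_set_le D0 Sg) IH.
by exists u; split => // n; have [] := gP (n, u n) (fu n).
Qed.

End gauge_preorder.

(** If d(x, y) = 0 for every gauge d, then y lies in every V_{d,e}(x), hence in
    every neighborhood of x; already this one-sided relation forces y = x in a
    T1 topology. *)
Lemma gauge_eq0_T1 (R : realType) (X : quasiUniformType)
    (D : set (X -> X -> R)) :
  @quasi_entourage X = gauge_entourage D -> accessible_space X ->
  forall x y : X, (forall d, D d -> d x y = 0%R) -> x = y.
Proof.
move=> X_gen X_T1 x y d0; apply: contrapT => /eqP /X_T1[A [oA]].
rewrite !inE => Ax; apply.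
have : nbhs x A by exact: open_nbhs_nbhs.
rewrite quasi_nbhsE => -[B]; rewrite X_gen => -[[d e] [/= Dd e0] dB]; apply.
by apply/mem_set/dB; rewrite /= d0.
Qed.

(** The common estimate of the proof: every later term competes in the infimum
    that an earlier term nearly attains, so what f still loses between the two
    terms bounds their distance. *)
Lemma near_minimizing_right_K_cauchy (R : realType) (X : quasiUniformType)
    (D : set (X -> X -> R)) (f : X -> \bar R) (u : nat -> X) :
  F_quasi_gauge D -> @quasi_entourage X = gauge_entourage D ->
  (forall n, f (u n) \is a fin_num) ->
  (forall n, S_set D f (u n) (u n.+1)) ->
  (forall n w, S_set D f (u n) w -> f (u n.+1) <= f w + (n.+1%:R^-1)%:E) ->
  right_K_cauchy u.
Proof.
move=> D_gauge X_gen fu uS umin U; rewrite X_gen => -[[d e] [/= Dd e0] dU].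
have [N] := ltr_add_invr e0; rewrite add0r => Ne.
(* The bound 1/(N+1) is for the term N+1, since x_{N+1} is the near-minimizer
   on S(x_N). *)
exists N.+1 => -[//|n] k Nn; apply: dU => /=.
apply: (@le_lt_trans _ _ (n.+1%:R^-1)%R); last first.
  by apply: le_lt_trans Ne; rewrite lef_pV2 ?posrE ?ltr0n // ler_nat.
have Snk := decreasing_S_set D_gauge n.+1 k uS.
rewrite -lee_fin -(leeD2lE _ _ (fu (n.+1 + k)%N)).
apply: (le_trans (Snk _ Dd)).
by apply: umin; exact: (S_set_trans D_gauge (uS n) Snk).
Qed.

Theorem theorem4p7 (R : realType) (X : quasiUniformType)
    (D : set (X -> X -> R)) (f : X -> \bar R)
    (D_gauge : F_quasi_gauge D)
    (X_gen : @quasi_entourage X = gauge_entourage D)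
    (f_range : forall x, f x != -oo)
    (X_complete : seq_right_K_complete X)
    (X_T1 : accessible_space X)
    (f_proper : proper_fun f)
    (f_bounded : bounded_below f)
    (S_closed : forall x : X, seq_closed (S_set D f x)) :
  forall x0 : X, edom f x0 ->
    exists z : X,
      (forall d, D d -> f z + (d z x0)%:E <= f x0) /\
      (forall x : X, x != z ->
         exists2 dx, D dx & f z < f x + (dx x z)%:E).
Proof.
move=> x0 fx0.
(* A filter contains the whole space, so a family that generates one is
   nonempty. *)
have D0 : D !=set0.
  have := @filterT _ _ (@quasi_entourage_filter X).
  by rewrite X_gen => -[[d e] [/= Dd _] _]; exists d.
have [u [u0 uS umin]] :=
  decreasing_minimizing_sequence D_gauge D0 f_bounded fx0.
have S_fin x y : edom f x -> S_set D f x y -> f y \is a fin_num.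
  move=> fx /(S_set_le D_gauge D0) fyx.
  by rewrite fin_numE f_range /= -ltey (le_lt_trans fyx fx).
have ufin n : f (u n) \is a fin_num.
  apply: (S_fin _ _ fx0); rewrite -u0.
  exact: (decreasing_S_set D_gauge 0 n uS).
have [z uz] := X_complete _
  (near_minimizing_right_K_cauchy D_gauge X_gen ufin uS umin).
have Sz n : S_set D f (u n) z.
  apply: (S_closed (u n) (fun k => u (n + k)%N)).
    by move=> k; exact: decreasing_S_set.
  by apply: cvg_comp uz; exact: cvg_addnl.
have Szx0 : S_set D f x0 z by rewrite -u0; exact: Sz.
exists z; split; first exact: Szx0.
move=> x xz; apply: contrapT => no_d; move/eqP: xz; apply.
have Szx : S_set D f z x.
  by move=> d Dd; rewrite leNgt; apply/negP => fzx; apply: no_d; exists d.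
have fx_fin : f x \is a fin_num.
  exact: S_fin fx0 (S_set_trans D_gauge Szx0 Szx).
have fzx : f z <= f x.
  apply/lee_addgt0Pr => e e0.
  have [n] := ltr_add_invr e0; rewrite add0r => ne.
  apply: (le_trans (S_set_le D_gauge D0 (Sz n.+1))).
  apply: (le_trans (umin n x (S_set_trans D_gauge (Sz n) Szx))).
  by apply: leeD => //; rewrite lee_fin ltW.
apply: (gauge_eq0_T1 X_gen X_T1) => d Dd.
apply/eqP; rewrite eq_le (gauge_ge0 D_gauge Dd) andbT.
rewrite -lee_fin -(leeD2lE _ _ fx_fin) adde0.
exact: le_trans (Szx _ Dd) fzx.
Qed.
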